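(* Let $\Phi$ be a finite integral gain graph. For every $m\in\mathbb{Z}$, the number $\chi^{\mathbb Z}_\Phi(m)$ of proper integral $m$-colorations of $\Phi$ is $$\chi^{\mathbb Z}_\Phi(m)=\sum_{B\in\operatorname{Lat}^{\mathrm b}\Phi}\mu(\varnothing,B)\prod_{W\in\pi(B)}\big[m-h_B(W)\big]^+ ,$$ where $\mu$ is the M\''obius function of $\operatorname{Lat}^{\mathrm b}\Phi$.
   Context: An integral gain graph $\Phi$ consists of a finite graph $(V,E)$ (loops and multiple edges allowed) and a gain function $\varphi$ assigning an integer to each oriented edge, with $\varphi(e^{-1})=-\varphi(e)$ when $e^{-1}$ is $e$ with the opposite orientation. The notation $g e_{ij}$ means an edge with endpoints $v_i,v_j$ whose gain in the direction from $v_i$ to $v_j$ is $g$. The gain of a path or circle is the sum of the gains of its edges, all oriented in the direction of traversal. A circle is a connected subgraph that is regular of degree 2, or its edge set (a loop is a circle of length 1). An edge set is balanced if every circle contained in it has gain $0$. A balanced edge set $B$ is closed if it contains every edge $g e_{ij}$ of $\Phi$ such that $B$ contains a path (possibly of length $0$) from $v_i$ to $v_j$ with gain $g$. $\operatorname{Lat}^{\mathrm b}\Phi$ is the set of all closed, balanced edge sets, ordered by inclusion. Convention: if $\Phi$ has a loop of gain $0$, so that $\varnothing$ is not closed, every $\mu(\varnothing,B)$ is read as $0$. For a balanced set $B$, $\pi(B)$ is the partition of $V$ into the vertex sets of the connected components of $(V,B)$. For $W\in\pi(B)$, the height $h_B(W)$ is the maximum gain of a path (in either direction, length $0$ with gain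 $0$ allowed) in the component of $(V,B)$ with vertex set $W$. For $m\in\mathbb Z$, $[m]=\{1,\dots,m\}$ (empty if $m\le 0$). An integral $m$-coloration is a function $x:V\to[m]$, $v_i\mapsto x_i$; it is proper if $x_j\ne x_i+g$ for every edge $g e_{ij}$ of $\Phi$. For real $r$, $r^+=\max(r,0)$. *)

(* Defs.v *)
From mathcomp Require Import all_boot all_order all_algebra.

Set Implicit Arguments.
Unset Strict Implicit.
Unset Printing Implicit Defensive.

Import Order.TTheory GRing.Theory Num.Theory.
Local Open Scope ring_scope.

(* Loops, and parallel edges (even with equal gains), are allowed. [gain e] is
   the gain of [e] in the direction from [esrc e] to [etgt e]. *)
Record gain_graph := GainGraph {
  vertex : finType;
  edge : finType;
  esrc : edge -> vertex;
  etgt : edge -> vertex;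
  gain : edge -> int
}.

Section GainGraph.
Variable Phi : gain_graph.
Implicit Types (A B : {set edge Phi}) (u w : vertex Phi).

(* An oriented edge; the boolean is [true] when the edge is reversed. A loop
   also has two orientations, with opposite gains. *)
Definition dart : finType := (edge Phi * bool)%type.
Definition dsrc (d : dart) : vertex Phi := if d.2 then etgt d.1 else esrc d.1.
Definition dtgt (d : dart) : vertex Phi := if d.2 then esrc d.1 else etgt d.1.
Definition dgain (d : dart) : int := if d.2 then - gain d.1 else gain d.1.

Implicit Types (d : dart) (p c : seq dart).

Definition walk_gain p : int := \sum_(d <- p) dgain d.

Fixpoint is_walk B u w p : bool :=
  if p is d :: p' then [&& d.1 \in B, dsrc d == u & is_walk B (dtgt d) w p']
  else u == w.

Definition is_path B u w p : bool :=
  is_walk B u w p && uniq (u :: [seq dtgt d | d <- p]).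

(* A circle of [B], given by a traversal: a nonempty closed walk with no
   repeated vertex and no repeated edge. Distinctness of the edges only matters
   in length 2, where it excludes an edge followed by its reverse. *)
Definition is_circle B c : bool :=
  [&& c != [::], [exists u, is_walk B u u c], uniq [seq dtgt d | d <- c]
    & uniq [seq d.1 | d <- c]].

(* Paths and circles have at most #|V| edges, so that bounded sequences suffice
   below; see [balancedP], [closedP] and [heightP]. *)
Definition balanced B : bool :=
  [forall c : #|vertex Phi|.-bseq dart, is_circle B c ==> (walk_gain c == 0)].

Definition closed_balanced B : bool :=
  balanced B &&
  [forall d : dart, forall p : #|vertex Phi|.-bseq dart,
    is_path B (dsrc d) (dtgt d) p && (walk_gain p == dgain d) ==> (d.1 \in B)].

Definition Latb : {set {set edge Phi}} := [set B | closed_balanced B].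

Definition adjacent B : rel (vertex Phi) :=
  [rel u w | [exists d : dart, [&& d.1 \in B, dsrc d == u & dtgt d == w]]].

Definition components B : {set {set vertex Phi}} :=
  equivalence_partition (connect (adjacent B)) [set: vertex Phi].

(* The default value 0 is the gain of a path of length 0. *)
Definition height B (W : {set vertex Phi}) : int :=
  \big[Num.max/0]_(u in W) \big[Num.max/0]_(w in W)
    \big[Num.max/0]_(p : #|vertex Phi|.-bseq dart | is_path B u w p)
      walk_gain p.

(* The set [m] = {1, ..., m}, empty for m <= 0, is encoded as
   'I_(num_colors m), where the ordinal i stands for the color i + 1. *)
Definition num_colors (m : int) : nat := if m is Posz n then n else 0%N.

Definition color n (i : 'I_n) : int := i.+1%:Z.

Definition proper n (x : {ffun vertex Phi -> 'I_n}) : bool :=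
  [forall d : dart, color (x (dtgt d)) != color (x (dsrc d)) + dgain d].

Definition chiZ (m : int) : nat :=
  #|[set x : {ffun vertex Phi -> 'I_(num_colors m)} | proper x]|.

Lemma path_size B u w p : is_path B u w p -> (size p <= #|vertex Phi|)%N.
Proof.
case/andP=> _ /card_uniqP; rewrite /= size_map => e.
by apply: ltnW; rewrite -e max_card.
Qed.

Lemma circle_size B c : is_circle B c -> (size c <= #|vertex Phi|)%N.
Proof.
case/and4P=> _ _ /card_uniqP; rewrite size_map => <- _.
exact: max_card.
Qed.

Lemma balancedP B :
  reflect (forall c, is_circle B c -> walk_gain c = 0) (balanced B).
Proof.
apply: (iffP forallP) => [H c Hc | H c].
  by have /implyP/(_ Hc)/eqP := H (Bseq (circle_size Hc)).
by apply/implyP => /H ->.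
Qed.

Lemma closedP B :
  reflect (balanced B /\
    forall d p, is_path B (dsrc d) (dtgt d) p -> walk_gain p = dgain d ->
      d.1 \in B)
  (closed_balanced B).
Proof.
apply: (iffP andP) => -[bB H]; split=> //.
  move=> d p Hp Hg; move/forallP: H => /(_ d)/forallP/(_ (Bseq (path_size Hp))).
  by rewrite /= Hp Hg eqxx.
apply/forallP => d; apply/forallP => p; apply/implyP => /andP[Hp /eqP].
exact: H.
Qed.

Lemma heightP B W : W \in components B ->
  (exists u w p, [/\ u \in W, w \in W, is_path B u w p
                   & walk_gain p = height B W]) /\
  (forall u w p, u \in W -> w \in W -> is_path B u w p ->
     walk_gain p <= height B W).
Proof.
case/imsetP=> v _ defW.
have vW : v \in W by rewrite defW inE /= inE connect0.
split; last first.
  move=> u w p uW wW Hp; apply: le_trans (le_bigmax_cond _ _ uW).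
  apply: le_trans (le_bigmax_cond _ _ wW).
  exact: (le_bigmax_cond _ (fun q : _.-bseq dart => walk_gain q)
            (j := Bseq (path_size Hp))).
pose K z := exists u w p,
  [/\ u \in W, w \in W, is_path B u w p & walk_gain p = z].
have K0 : K 0.
  exists v, v, [::]; split; rewrite /walk_gain ?big_nil //.
  by rewrite /is_path /= eqxx.
have Kmax x y : K x -> K y -> K (Num.max x y) by rewrite /Order.max; case: ifP.
rewrite -/(K (height B W)) /height.
elim/big_ind: _ => // u uW; elim/big_ind: _ => // w wW.
by elim/big_ind: _ => // p Hp; exists u, w, p.
Qed.

End GainGraph.

(* The Moebius function of a family [L] of sets ordered by inclusion, by the
   usual recursion mu(A, A) = 1, mu(A, B) = - \sum_(A <= C < B) mu(A, C); the
   natural number bounds the depth of the recursion. It is 0 unless A and B are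
   members of L with A included in B, so that mu(set0, B) = 0 for all B when
   set0 is not in L. *)
Section Moebius.
Variables (T : finType) (L : {set {set T}}).
Implicit Types A B C : {set T}.

Fixpoint moebius_rec n A B : int :=
  if n is n'.+1 then
    if A == B then 1
    else - \sum_(C in L | (A \subset C) && (C \proper B)) moebius_rec n' A C
  else 0.

Definition moebius A B : int :=
  if [&& A \in L, B \in L & A \subset B] then moebius_rec #|B|.+1 A B else 0.

Lemma moebius_rec_fuel n n' A B :
  (#|B| < n)%N -> (#|B| < n')%N -> moebius_rec n A B = moebius_rec n' A B.
Proof.
elim: n n' B => [|n IH] [|n'] B //= lt1 lt2; case: eqP => // _.
congr (- _); apply: eq_bigr => C /and3P[_ _ /proper_card ltCB].
by apply: IH; apply: leq_trans ltCB _.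
Qed.

Lemma moebiusE A B : A \in L -> B \in L -> A \subset B ->
  \sum_(C in L | (A \subset C) && (C \subset B)) moebius A C = (A == B)%:R.
Proof.
move=> AL BL sAB; rewrite (bigD1 B) /=; last by rewrite BL sAB subxx.
rewrite {1}/moebius AL BL sAB /=; case: eqP => [<- | neqAB].
  rewrite big1 ?addr0 // => C /andP[/and3P[_ sAC sCA]].
  by rewrite eqEsubset sCA sAC.
apply/eqP; rewrite addrC subr_eq0; apply/eqP.
have eP C : [&& C \in L, A \subset C & C \subset B] && (C != B)
    = [&& C \in L, A \subset C & C \proper B].
  by rewrite properEneq -!andbA [(C \subset B) && _]andbC.
rewrite (eq_bigl _ _ eP); apply: eq_bigr => C /and3P[CL sAC ltCB].
rewrite /moebius AL CL sAC /=.
exact: (@moebius_rec_fuel #|C|.+1 #|B|) (ltnSn _) (proper_card ltCB).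
Qed.

End Moebius.

(* Main.v *)
Require Import Defs.
From mathcomp Require Import all_boot all_order all_algebra.
From mathcomp Require Import zify.

Set Implicit Arguments.
Unset Strict Implicit.
Unset Printing Implicit Defensive.

Import Order.TTheory GRing.Theory Num.Theory.
Local Open Scope ring_scope.

(** The edges that a coloration [x] violates form a closed balanced set [I x],
    and [x] is proper exactly when [I x] is empty. Summing
    [\sum_(B in Latb | B \subset I x) mu(set0, B)] over all [x] therefore counts
    the proper colorations, and exchanging the two sums leaves, for each closed
    balanced [B], the number of colorations [x] with [B \subset I x].
    A balanced [B] has a potential [t], and these [x] are the colorations for
    which [x - t] is constant on each component [W] of [B]. Such an [x] is
    determined on [W] by its value at a minimum of [t], which can be chosen in
    [m - h_B(W)] ways because the height is the oscillation of [t] on [W]. *)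

Section Potential.
Context {Phi : gain_graph}.
Implicit Types (A B : {set edge Phi}) (u w : vertex Phi).
Implicit Types (t : vertex Phi -> int).
Implicit Types (d : dart Phi) (p : seq (dart Phi)).

Definition tight t : {set edge Phi} :=
  [set e | t (etgt e) == t (esrc e) + gain e].

Lemma tight_dart t d : (d.1 \in tight t) = (t (dtgt d) == t (dsrc d) + dgain d).
Proof.
case: d => e []; rewrite inE /dtgt /dsrc /dgain //=.
by rewrite eq_sym -subr_eq opprK.
Qed.

Lemma walk_gain_potential B t u w p :
  B \subset tight t -> is_walk B u w p -> walk_gain p = t w - t u.
Proof.
move=> sBt; elim: p u => [|d p IH] u /=.
  by move=> /eqP ->; rewrite /walk_gain big_nil subrr.
case/and3P=> dB /eqP <- /IH; rewrite /walk_gain big_cons => ->.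
have := subsetP sBt _ dB; rewrite tight_dart => /eqP ->; lia.
Qed.

Lemma closed_balanced_tight t : closed_balanced (tight t).
Proof.
apply/closedP; split=> [|d p /andP[dp _]].
  apply/balancedP => c /and4P[_ /existsP[u uc] _ _].
  by rewrite (walk_gain_potential (subxx _) uc) subrr.
rewrite (walk_gain_potential (subxx _) dp) tight_dart => <-.
by rewrite addrC subrK.
Qed.

Lemma walk_subset A B u w p : A \subset B -> is_walk A u w p -> is_walk B u w p.
Proof.
move=> /subsetP sAB; elim: p u => //= d p IH u /and3P[dA -> /IH ->].
by rewrite sAB.
Qed.

Lemma balanced_subset A B : A \subset B -> balanced B -> balanced A.
Proof.
move=> sAB /balancedP bB; apply/balancedP => c /and4P[c0 /existsP[u uc] c1 c2].
apply: bB; rewrite /is_circle c0 c1 c2 !andbT.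
by apply/existsP; exists u; apply: walk_subset uc.
Qed.

Lemma walk_edge B u w p e :
  is_walk B u w p -> e \in [seq d.1 | d <- p] -> e \in B.
Proof.
elim: p u => //= d p IH u /and3P[dB _ /IH H]; rewrite inE.
by case/orP=> [/eqP -> | /H].
Qed.

Lemma path_edge_uniq B u w p : is_path B u w p -> uniq [seq d.1 | d <- p].
Proof.
case/andP; elim: p u => //= d p IH u /and3P[_ /eqP du dp] /and3P[uN dN up].
rewrite {}(IH _ dp) ?andbT /=; last by rewrite dN.
apply/mapP => -[d' d'p ed]; move: uN dN; rewrite inE negb_or => /andP[_].
have := map_f (@dtgt Phi) d'p; rewrite -{}du.
case: d' d ed {d'p dp} => e b [e' b'] /= ->.
by case: b b' => [] [] /=; rewrite /dtgt /dsrc /= => ->.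
Qed.

Lemma adjacent_sym B : symmetric (adjacent B).
Proof.
suff H u w : adjacent B u w -> adjacent B w u
  by move=> u w; apply/idP/idP => /H.
case/existsP=> -[e b] /and3P[/= eB uE wE].
apply/existsP; exists (e, ~~ b); rewrite /= eB.
by case: b uE wE; rewrite /dsrc /dtgt /= => -> ->.
Qed.

Lemma connect_path B u w :
  connect (adjacent B) u w -> exists p, is_path B u w p.
Proof.
case/connectP=> _ /shortenP[q uq Uq _] ->; rewrite /is_path.
suff [p wp eqp] : exists2 p, is_walk B u (last u q) p
    & [seq dtgt d | d <- p] = q.
  by exists p; rewrite wp eqp.
elim: q u uq {Uq} => [|v q IH] u /=; first by exists [::] => /=.
case/andP=> /existsP[d /and3P[dB du /eqP dv]] /IH[p wp eqp].
by exists (d :: p); rewrite /= ?dB ?du ?dv ?eqp.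
Qed.

(* Adding an edge between two components, one of them can be shifted; adding
   an edge inside a component creates a circle, whose gain is 0. *)
Lemma balanced_potential B : balanced B -> exists t, B \subset tight t.
Proof.
elim: {B}#|B| {-2}B (erefl #|B|) => [|n IH] B cardB bB.
  by exists (fun=> 0); rewrite (cards0_eq cardB) sub0set.
have /card_gt0P[e eB] : (0 < #|B|)%N by rewrite cardB.
have sB : B :\ e \subset B by rewrite subD1set.
have [||t tB] := IH (B :\ e); last 1 first.
- have [/connect_path[p pB]|Nc] :=
    boolP (connect (adjacent (B :\ e)) (etgt e) (esrc e)).
  + exists t; rewrite -(setD1K eB) subUset tB sub1set andbT.
    have [wp up] := andP pB.
    have cp : is_circle B ((e, false) :: p).
      apply/and4P; split=> //=; last first.
        rewrite (path_edge_uniq pB) andbT.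
        by apply/negP => /(walk_edge wp); rewrite !inE eqxx.
      by apply/existsP; exists (esrc e); rewrite /= eB eqxx (walk_subset sB wp).
    have /balancedP/(_ _ cp) := bB; rewrite /walk_gain big_cons.
    have := walk_gain_potential tB wp; rewrite /walk_gain => ->.
    by rewrite /dgain inE /=; lia.
  + pose r := connect (adjacent (B :\ e)) (etgt e).
    pose s := t (esrc e) + gain e - t (etgt e).
    exists (fun u => t u + if r u then s else 0).
    apply/subsetP => f fB; rewrite inE.
    have [-> | nef] := eqVneq f e.
      by rewrite /r connect0 (negPf Nc) /s; lia.
    have fB' : f \in B :\ e by rewrite !inE nef.
    have rf : r (etgt f) = r (esrc f).
      have cs : connect_sym (adjacent (B :\ e)) :=
        sym_connect_sym (adjacent_sym _).
      rewrite /r; apply/esym/same_connect_r => //; apply: connect1.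
      by apply/existsP; exists (f, false); rewrite fB' /dsrc /dtgt /= !eqxx.
    by have := subsetP tB _ fB'; rewrite inE rf; lia.
- by move: cardB; rewrite (cardsD1 e) eB => -[].
- exact: balanced_subset bB.
Qed.

Lemma mem_component B W u w : W \in components B -> u \in W ->
  (w \in W) = connect (adjacent B) u w.
Proof.
case/imsetP=> v _ ->; rewrite !inE /= => vu.
exact: (same_connect (sym_connect_sym (adjacent_sym B)) vu).
Qed.

Lemma component_exists B u : exists2 W, W \in components B & u \in W.
Proof.
exists [set w in [set: vertex Phi] | connect (adjacent B) u w].
  by apply/imsetP; exists u; rewrite ?inE.
by rewrite !inE connect0.
Qed.

Lemma component_uniq B W W' u : W \in components B -> W' \in components B ->
  u \in W -> u \in W' -> W = W'.
Proof.
move=> cW cW' uW uW'; apply/setP => w.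
by rewrite (mem_component _ cW uW) (mem_component _ cW' uW').
Qed.

Lemma component_minimum B t W : W \in components B ->
  exists2 v, v \in W & forall u, u \in W -> t v <= t u.
Proof.
case/imsetP=> v0 _ defW; have v0W : v0 \in W by rewrite defW !inE /=.
by case: (arg_minP t v0W) => v vW vmin; exists v.
Qed.

Lemma height_ge0 B W : W \in components B -> 0 <= height B W.
Proof.
move=> cW; have [v vW _] := component_minimum (fun=> 0) cW.
have := (heightP cW).2 v v [::] vW vW.
by rewrite /walk_gain big_nil; apply; rewrite /is_path /= eqxx.
Qed.

Lemma height_potential B t W v : B \subset tight t -> W \in components B ->
    v \in W -> (forall u, u \in W -> t v <= t u) ->
  (exists2 u, u \in W & height B W <= t u - t v) /\
  (forall u, u \in W -> t u - t v <= height B W).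
Proof.
move=> tB cW vW vmin; have [[u [w [p [uW wW pB <-]]]] maxW] := heightP cW.
split.
  exists w => //; have /andP[wp _] := pB.
  by rewrite (walk_gain_potential tB wp) lerD2l lerN2 vmin.
move=> u' u'W; have [|q qB] := @connect_path B v u'.
  by rewrite -(mem_component _ cW vW).
have /andP[wq _] := qB; rewrite -(walk_gain_potential tB wq).
exact: maxW qB.
Qed.

Lemma tight_const B t s W u w : B \subset tight t -> B \subset tight s ->
  W \in components B -> u \in W -> w \in W -> s w - s u = t w - t u.
Proof.
move=> tB sB cW uW; rewrite (mem_component _ cW uW) => /connect_path[p].
case/andP=> pB _.
by rewrite -(walk_gain_potential tB pB) (walk_gain_potential sB pB).
Qed.

End Potential.

Section Count.
Context {Phi : gain_graph} (n : nat).
Implicit Types (B : {set edge Phi}) (x : {ffun vertex Phi -> 'I_n}).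

Definition colors x (u : vertex Phi) : int := color (x u).

Lemma properE x : Defs.proper x = (tight (colors x) == set0).
Proof.
apply/forallP/eqP => [H | H d].
  apply/setP => e; rewrite in_set0; apply/negbTE.
  by have := H (e, false); rewrite -(tight_dart (colors x)).
by rewrite -(tight_dart (colors x)) H inE.
Qed.

Lemma card_ord_shift (h : int) : 0 <= h ->
  #|[set i : 'I_n | i%:Z + h < n%:Z]|%:Z = Num.max (n%:Z - h) 0.
Proof.
case: h => // k _; have -> : #|[set i : 'I_n | i%:Z + k%:Z < n%:Z]| = (n - k)%N.
  rewrite -[RHS]card_ord -[RHS]sum1_card -sum1_card.
  rewrite -(big_ord_narrow (leq_subr k n) (F := fun=> 1%N)).
  by apply: eq_bigl => i; rewrite inE; lia.
by lia.
Qed.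

Lemma card_tight_colorings B : balanced B ->
  #|[set x | B \subset tight (colors x)]|%:Z =
  \prod_(W in components B) Num.max (n%:Z - height B W) 0.
Proof.
case/balanced_potential=> t tB.
pose T : finType := {W | W \in components B}.
have /fin_all_exists[lo loP] (W : T) :
    exists v, v \in val W /\ forall u, u \in val W -> t v <= t u.
  by have [v] := component_minimum t (valP W); exists v.
have /fin_all_exists[cl clP] u : exists W : T, u \in val W.
  by have [W cW uW] := component_exists B u; exists (exist _ W cW).
have clE (W : T) u : u \in val W -> cl u = W.
  move=> uW; apply/val_inj.
  apply: component_uniq (valP _) (valP _) (clP u) uW.
pose F (W : T) := [set i : 'I_n | i%:Z + height B (val W) < n%:Z].
pose f x : {ffun T -> 'I_n} := [ffun W => x (lo W)].
have xE x u : B \subset tight (colors x) ->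
    (x u)%:Z = (x (lo (cl u)))%:Z + (t u - t (lo (cl u))).
  move=> xB; have := tight_const tB xB (valP (cl u)) (loP (cl u)).1 (clP u).
  by rewrite /colors /color; lia.
have finj : {in [set x | B \subset tight (colors x)] &, injective f}.
  move=> x y; rewrite !inE => xB yB /ffunP exy; apply/ffunP => u.
  apply: ord_inj; apply/eqP; rewrite -eqz_nat (xE x) // (xE y) //.
  by have := exy (cl u); rewrite !ffunE => ->.
rewrite -(card_in_imset finj).
have -> : #|f @: [set x | B \subset tight (colors x)]| = #|family F|.
  apply: eq_card => k; apply/imsetP/familyP => [[x] | kF].
    rewrite inE => xB -> W; rewrite ffunE inE.
    have [[u uW le_h] _] := height_potential tB (valP W) (loP W).1 (loP W).2.
    apply: le_lt_trans (ltn_ord (x u) : (x u)%:Z < n%:Z).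
    by rewrite (xE x u) // (clE W u uW) lerD2l.
  pose c u := `|((k (cl u))%:Z + (t u - t (lo (cl u))))%R|%N.
  have cE u : (c u)%:Z = (k (cl u))%:Z + (t u - t (lo (cl u))).
    by have := (loP (cl u)).2 u (clP u); rewrite /c; lia.
  pose x := [ffun u => insubd (k (cl u)) (c u) : 'I_n].
  have xcE u : (x u)%:Z = (k (cl u))%:Z + (t u - t (lo (cl u))).
    rewrite -cE ffunE insubdK // unfold_in /=.
    have [_ ] :=
      height_potential tB (valP (cl u)) (loP (cl u)).1 (loP (cl u)).2.
    move=> /(_ u (clP u)); have := kF (cl u); rewrite inE; have := cE u; lia.
  exists x.
    rewrite inE; apply/subsetP => e eB; rewrite inE /colors /color.
    have ce : cl (etgt e) = cl (esrc e).
      apply: clE; rewrite (mem_component _ (valP _) (clP _)).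
      apply/connect1/existsP; exists (e, false).
      by rewrite eB /dsrc /dtgt /= !eqxx.
    have := xcE (etgt e); have := xcE (esrc e); rewrite ce.
    by have := subsetP tB _ eB; rewrite inE; lia.
  apply/ffunP => W; rewrite ffunE; apply: ord_inj.
  apply/eqP; rewrite -eqz_nat xcE.
  by rewrite (clE W) ?subrr ?addr0 // (loP W).1.
rewrite card_family foldrE big_map big_enum -[LHS]natz natr_prod /=.
under eq_bigr => W _ do rewrite natz card_ord_shift ?height_ge0 ?(valP W) //.
by rewrite [RHS]big_sub; apply: eq_bigl => W; rewrite inE.
Qed.

End Count.

Theorem theorem3p1 (Phi : gain_graph) (m : int) :
  (chiZ Phi m)%:Z =
  \sum_(B in Latb Phi)
    moebius (Latb Phi) set0 B *
    \prod_(W in components B) Num.max (m - height B W) 0.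
Proof.
set n := num_colors m.
have countE B : B \in Latb Phi ->
    \prod_(W in components B) Num.max (m - height B W) 0 =
    \sum_(x : {ffun vertex Phi -> 'I_n} | B \subset tight (colors x)) 1.
  rewrite inE => /closedP[bB _]; rewrite sumr_const -cardsE natz.
  rewrite card_tight_colorings //; apply: eq_bigr => W cW.
  by have := height_ge0 cW; rewrite /n /num_colors; case: (m) => k; lia.
under eq_bigr => B LB do rewrite countE // big_distrr /=.
rewrite (exchange_big_dep xpredT) //=.
rewrite -[LHS]natz /chiZ -sum1_card natr_sum big_mkcond /=.
apply: eq_bigr => x _; rewrite inE properE.
under eq_bigr do rewrite mulr1.
have LI : tight (colors x) \in Latb Phi by rewrite inE closed_balanced_tight.
have [L0|N0] := boolP (set0 \in Latb Phi); last first.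
  rewrite big1 => [|B _]; last by rewrite /moebius (negPf N0).
  by case: eqP LI => // ->; rewrite (negPf N0).
have := moebiusE L0 LI (sub0set _); rewrite [set0 == _]eq_sym.
rewrite (eq_bigl (fun B => (B \in Latb Phi) && (B \subset tight (colors x)))).
  by move=> ->; case: eqP.
by move=> B; rewrite sub0set.
Qed.
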